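(* Let $K:\mathcal X\to\mathcal Y$ be a compact linear operator. For any given $n\in\mathbb N$ ($n\ge1$) and $r>0$, the stationary iterated weighted Tikhonov method (SIWT) with $n$ iterations is a filter based regularization method, with filter function $$F_{\alpha,r}^{(n)}(\sigma)=\frac{(\sigma^{r+1}+\alpha)^n-\alpha^n}{(\sigma^{r+1}+\alpha)^n}.$$ Moreover, the method is of optimal order under the a-priori assumption $x^\dagger\in\mathcal X_{\nu,\rho}$, for $r>0$ and $0<\nu\le n(r+1)$, with best convergence rate $$\|x^\dagger-x_{\alpha,r}^{n,\delta}\|=O\Big(\delta^{\frac{n(r+1)}{1+n(r+1)}}\Big),$$ which is obtained for $\alpha=\big(\frac{\delta}{\rho}\big)^{\frac{n(r+1)}{1+\nu}}$ with $\nu=n(r+1)$. On the other hand, if $\|x^\dagger-x_{\alpha,r}^n\|=O(\alpha^n)$ (as $\alpha\to0$), then $x^\dagger\in\mathcal X_{n(r+1)}$.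
   Context: $\mathcal X,\mathcal Y$ are Hilbert spaces. $(\sigma_m;v_m,u_m)$ is the singular value expansion of $K$: $\sigma_1\ge\sigma_2\ge\dots>0$, $\{v_m\}$, $\{u_m\}$ orthonormal and complete in $(\ker K)^\perp$ and $\overline{R(K)}$, $Kv_m=\sigma_mu_m$, $K^*u_m=\sigma_mv_m$. $K^\dagger y=\sum_m\sigma_m^{-1}\langle y,u_m\rangle v_m$ for $y\in\mathcal D(K^\dagger)=\{y:\sum_m\sigma_m^{-2}|\langle y,u_m\rangle|^2<\infty\}$. The exact datum $y$ is attainable and $x^\dagger=K^\dagger y$; $y^\delta\in\mathcal Y$ is a noisy datum with $\|y-y^\delta\|\le\delta$. SIWT: for $\alpha>0$, $r\ge0$, $x_{\alpha,r}^0=0$ and $$\big((K^*K)^{\frac{r+1}2}+\alpha I\big)x_{\alpha,r}^n=(K^*K)^{\frac{r-1}2}K^*y+\alpha x_{\alpha,r}^{n-1},$$ where $(K^*K)^{\frac{r-1}2}K^*y:=\sum_m\sigma_m^r\langle y,u_m\rangle v_m$. $x_{\alpha,r}^{n,\delta}$ is the $n$-th iterate when $y$ is replaced by $y^\delta$. The iteration number $n$ is fixed and $\alpha$ is the regularization parameter, i.e. $R_\alpha y=x_{\alpha,r}^n$. A filter based regularization method with filter function $F_\alpha$ is a family $R_\alpha y=\sum_mF_\alpha(\sigma_m)\sigma_m^{-1}\langle y,u_m\rangle v_m$, $\alpha\in(0,\alpha_0)$ ($\alpha_0\in(0,\infty]$), with $F_\alpha$ Borel such that $\sup_m|F_\alpha(\sigma_m)\sigma_m^{-1}|<\infty$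 for each $\alpha$; $|F_\alpha(\sigma_m)|\le C$ with $C$ independent of $(\alpha,m)$; $\lim_{\alpha\to0}F_\alpha(\sigma_m)=1$ for each $m$. $\mathcal X_{\nu,\rho}=\{x\in\mathcal X:\ x=(K^*K)^{\nu/2}\omega \text{ for some } \omega\in\mathcal X,\ \|\omega\|\le\rho\}$ and $\mathcal X_\nu=\bigcup_{\rho>0}\mathcal X_{\nu,\rho}$. A method $R_\alpha$ is of optimal order under the a-priori assumption $x^\dagger\in\mathcal X_{\nu,\rho}$ if, with a suitable choice $\alpha=\alpha(\delta,\rho)$, $\sup\{\|x^\dagger-R_\alpha y^\delta\|:x^\dagger\in\mathcal X_{\nu,\rho},\|y-y^\delta\|\le\delta\}\le c\,\delta^{\frac{\nu}{\nu+1}}\rho^{\frac1{\nu+1}}$ with $c$ independent of $\delta,\rho$. ''Best convergence rate'' refers to the largest exponent among the optimal-order rates $\delta^{\nu/(\nu+1)}$ for the admissible range of $\nu$.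
   Formalization: The parameter choice is corrected to α=(δ/ρ)^{(r+1)/(1+ν)}, ν=n(r+1), in place of the printed exponent n(r+1)/(1+ν), which agrees for n=1 but does not give the stated rate for n≥2 when K has infinite rank. *)

(* Defs.v *)
From HB Require Import structures.
From mathcomp Require Import all_boot all_order all_algebra.
From mathcomp Require Import sesquilinear complex.
From mathcomp Require Import all_classical all_reals all_analysis.

Set Implicit Arguments.
Unset Strict Implicit.
Unset Printing Implicit Defensive.

Import Order.TTheory GRing.Theory Num.Theory.
Import numFieldNormedType.Exports.

Local Open Scope classical_set_scope.
Local Open Scope ring_scope.

(* Hilbert spaces are real or complex: [scalar R k] is R or R[i]. *)
Variant scalar_kind := RealScalars | ComplexScalars.

Definition scalar (R : realType) (k : scalar_kind) : numFieldType :=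
  match k with RealScalars => R | ComplexScalars => R[i] end.

Definition scalar_conj (R : realType) (k : scalar_kind) :
    scalar R k -> scalar R k :=
  match k with
  | RealScalars => fun z => z
  | ComplexScalars => fun z : R[i] => z^*
  end.

Definition of_real (R : realType) (k : scalar_kind) : R -> scalar R k :=
  match k with
  | RealScalars => fun t => t
  | ComplexScalars => fun t : R => t%:C%C
  end.

Definition real_part (R : realType) (k : scalar_kind) : scalar R k -> R :=
  match k with
  | RealScalars => fun z => z
  | ComplexScalars => fun z : R[i] => complex.Re z
  end.

Record hilbert (R : realType) (k : scalar_kind) := Hilbert {
  hspace :> completeNormedModType (scalar R k);
  inner : {dot hspace for @scalar_conj R k};
  inner_norm : forall x : hspace, `|x| ^+ 2 = inner x x }.

Section Defs.
Variables (R : realType) (k : scalar_kind).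
Implicit Types X Y : hilbert R k.

Local Notation F := (scalar R k).
Local Notation "t %:Sc" := (of_real k t) (at level 1, format "t %:Sc").
Definition ip X (x y : X) : F := inner X x y.

(* The library's norm takes its (real) values in the scalar field. *)
Definition hnorm X (x : X) : R := real_part `|x|.

Definition compact_operator X Y (K : X -> Y) : Prop :=
  forall A : set X, bounded_set A -> precompact (K @` A).

Definition adjoint X Y (K : X -> Y) (Ks : Y -> X) : Prop :=
  forall x y, ip (K x) y = ip x (Ks y).

Definition orthonormal_on X (I : pred nat) (e : nat -> X) : Prop :=
  forall m p, I m -> I p -> ip (e m) (e p) = (m == p)%:R.

Definition span_on X (I : pred nat) (e : nat -> X) : set X :=
  [set x | exists (N : nat) (c : nat -> F),
             x = \sum_(0 <= m < N | I m) c m *: e m].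

Definition ker_perp X Y (K : X -> Y) : set X :=
  [set x | forall z, K z = 0 -> ip x z = 0].

(* The index set is an initial segment of nat, which covers operators of
   finite as well as of infinite rank; [sv], [rvec], [lvec] are irrelevant
   outside it. *)
Record sve X Y (K : X -> Y) (Ks : Y -> X) := SVE {
  idx : pred nat;
  sv : nat -> R;
  rvec : nat -> X;
  lvec : nat -> Y;
  idx_down : forall m p, (m <= p)%N -> idx p -> idx m;
  sv_gt0 : forall m, idx m -> 0 < sv m;
  sv_noninc : forall m p, (m <= p)%N -> idx p -> sv p <= sv m;
  rvec_orthonormal : orthonormal_on idx rvec;
  lvec_orthonormal : orthonormal_on idx lvec;
  rvec_complete : closure (span_on idx rvec) = ker_perp K;
  lvec_complete : closure (span_on idx lvec) = closure (range K);
  sv_rvec : forall m, idx m -> K (rvec m) = (sv m)%:Sc *: lvec m;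
  sv_lvec : forall m, idx m -> Ks (lvec m) = (sv m)%:Sc *: rvec m }.

Section Method.
Variables (X Y : hilbert R k) (K : X -> Y) (Ks : Y -> X) (S : sve K Ks).

Local Notation s := (sv S).
Local Notation v := (rvec S).
Local Notation u := (lvec S).

(* Partial sums of \sum_m c_m <x, v_m> v_m and of \sum_m c_m <y, u_m> v_m. *)
Definition vv_sum (c : nat -> R) (x : X) (N : nat) : X :=
  \sum_(0 <= m < N | idx S m) ((c m)%:Sc * ip x (v m)) *: v m.

Definition uv_sum (c : nat -> R) (y : Y) (N : nat) : X :=
  \sum_(0 <= m < N | idx S m) ((c m)%:Sc * ip y (u m)) *: v m.

(* (K^* K)^p, p > 0, by functional calculus: K^* K v_m = s_m^2 v_m. *)
Definition normal_pow (p : R) (x : X) : X :=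
  limn (vv_sum (fun m => s m `^ (2 * p)) x).

(* (K^* K)^((r-1)/2) K^* *)
Definition weighted_adjoint (r : R) (y : Y) : X :=
  limn (uv_sum (fun m => s m `^ r) y).

(* The Moore-Penrose inverse; meaningful where the series converges, in
   particular on the range of K. *)
Definition mp_inverse (y : Y) : X := limn (uv_sum (fun m => (s m)^-1) y).

Definition siwt_sequence (r a : R) (y : Y) (x : nat -> X) : Prop :=
  x 0%N = 0 /\
  forall n, normal_pow ((r + 1) / 2) (x n.+1) + a%:Sc *: x n.+1
            = weighted_adjoint r y + a%:Sc *: x n.

(* The n-th iterate as a function of the parameter and the datum. *)
Definition siwt (r : R) (n : nat) (a : R) (y : Y) : X :=
  xget (fun=> 0) [set x | siwt_sequence r a y x] n.

Definition siwt_filter (r : R) (n : nat) (a t : R) : R :=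
  ((t `^ (r + 1) + a) ^+ n - a ^+ n) / (t `^ (r + 1) + a) ^+ n.

Record filter_method (a0 : \bar R) (Rm : R -> Y -> X) (Fa : R -> R -> R)
    : Prop := FilterMethod {
  filter_borel : forall a, 0 < a -> (a%:E < a0)%E ->
    measurable_fun (`[0, +oo[ : set R) (Fa a);
  filter_expansion : forall a y, 0 < a -> (a%:E < a0)%E ->
    uv_sum (fun m => Fa a (s m) / s m) y @ \oo --> Rm a y;
  filter_bounded : forall a, 0 < a -> (a%:E < a0)%E ->
    exists M, forall m, idx S m -> `|Fa a (s m) / s m| <= M;
  filter_unif_bounded : exists C, forall a m, 0 < a -> (a%:E < a0)%E ->
    idx S m -> `|Fa a (s m)| <= C;
  filter_limit : forall m, idx S m -> Fa a (s m) @[a --> 0^'+] --> (1 : R) }.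

Definition source_ball (nu rho : R) : set X :=
  [set x | exists2 w, hnorm w <= rho & x = normal_pow (nu / 2) w].

Definition source_set (nu : R) : set X :=
  \bigcup_(rho in [set rho | 0 < rho]) source_ball nu rho.

Definition worst_error (Ra : Y -> X) (nu rho delta : R) : \bar R :=
  ereal_sup [set e | exists y yd, [/\ range K y,
    source_ball nu rho (mp_inverse y), hnorm (y - yd) <= delta
    & e = (hnorm (mp_inverse y - Ra yd))%:E]].

Definition optimal_order_with (alpha : R -> R -> R) (a0 : \bar R)
    (Rm : R -> Y -> X) (nu : R) : Prop :=
  exists c : R, forall delta rho, 0 < delta -> 0 < rho ->
    [/\ 0 < alpha delta rho, ((alpha delta rho)%:E < a0)%E
      & (worst_error (Rm (alpha delta rho)) nu rho delta
         <= (c * delta `^ (nu / (nu + 1)) * rho `^ ((nu + 1)^-1))%:E)%E].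

Definition optimal_order (a0 : \bar R) (Rm : R -> Y -> X) (nu : R) : Prop :=
  exists alpha, optimal_order_with alpha a0 Rm nu.

End Method.
End Defs.

(* Main.v *)
Require Import Defs.
From HB Require Import structures.
From mathcomp Require Import all_boot all_order all_algebra.
From mathcomp Require Import sesquilinear complex.
From mathcomp Require Import ring lra.
From mathcomp Require Import all_classical all_reals all_analysis.
From mathcomp Require Import measurable_realfun.

Set Implicit Arguments.
Unset Strict Implicit.
Unset Printing Implicit Defensive.

Import Order.TTheory GRing.Theory Num.Theory.
Import numFieldNormedType.Exports.

Local Open Scope classical_set_scope.
Local Open Scope ring_scope.

(** Everything is diagonal in the singular system. Fix [a > 0] and write
    [q = a / (t^(r+1) + a)]; in the direction of the singular value [t] one
    step of the iteration multiplies the distance to the solution by [q], so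
    that the filter is [1 - q^n]. Hence the only analysis needed in the Hilbert
    spaces is Bessel's inequality and the Riesz-Fischer theorem for an
    orthonormal family: a series with square-summable coefficients converges,
    its sum has these coefficients, and its norm is bounded by their
    square sum ([bessel], [riesz_fischer], [coef_lim], [hnorm_lim_le]).

    The series with coefficients [(1 - q^n) / t] satisfies the recursion
    ([filtered_step]), and the recursion determines the iterates because
    [(K^* K)^((r+1)/2) + a] is injective; so it is the [n]-th iterate
    ([siwtE]).

    For the rates, the total error splits into two parts. The approximation
    error has coefficients [q^n t^nu] against the source element, and
    [q^n <= q^theta] with [theta = nu / (r + 1) <= n], while [q t^(r+1) <= a];
    so these coefficients are at most [a^(nu/(r+1))] ([residual_rate]). The
    propagated noise is multiplied by [(1 - q^n) / t], and
    [1 - q^n <= n (1 - q) <= n (1 - q)^(1/(r+1))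
       <= n (t^(r+1) / a)^(1/(r+1)) = n t a^(-1/(r+1))]
    ([siwt_filter_div_le]). The choice [a^(1/(r+1)) = (delta/rho)^(1/(nu+1))]
    makes both parts multiples of [delta^(nu/(nu+1)) rho^(1/(nu+1))]
    ([error_le]). The exponent [nu / (nu + 1)] increases with [nu], so the
    largest one is reached at [nu = n (r + 1)].

    Conversely, let [w_m] be the coefficients of the exact solution and
    suppose that the error is at most [C a^n] for small [a]. Then
    [sum (q_m^n |w_m|)^2 <= C^2 a^(2n)]. For the first [N] singular values,
    every small [a <= t_N^(r+1)] gives [a / (2 t_m^(r+1)) <= q_m], whence
    [sum_(m <= N) (t_m^(-n(r+1)) |w_m|)^2 <= (2^n C)^2]. The bound does not
    depend on [N], and Riesz-Fischer provides the source element
    ([source_of_rate]). *)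

(** * Scalars *)

Section ScalarMorphisms.
Variables (R : realType) (k : scalar_kind).
Local Notation F := (Defs.scalar R k).
Local Notation "t %:Sc" := (of_real k t) (at level 1, format "t %:Sc").

Lemma of_real_is_zmod_morphism : zmod_morphism (@of_real R k).
Proof. by case: k => // x y; rewrite /of_real /= rmorphB. Qed.

Lemma of_real_is_monoid_morphism : monoid_morphism (@of_real R k).
Proof. by case: k; split => // x y; rewrite /of_real /= rmorphM. Qed.

Lemma scalar_conj_is_zmod_morphism : zmod_morphism (@scalar_conj R k).
Proof. by case: k => // x y; rewrite /scalar_conj /= rmorphB. Qed.

Lemma scalar_conj_is_monoid_morphism : monoid_morphism (@scalar_conj R k).
Proof.
case: k; split => //; rewrite /scalar_conj /= ?rmorph1// => x y.
by rewrite rmorphM.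
Qed.

End ScalarMorphisms.

HB.instance Definition _ (R : realType) (k : scalar_kind) :=
  GRing.isZmodMorphism.Build R (Defs.scalar R k) (@of_real R k)
    (@of_real_is_zmod_morphism R k).
HB.instance Definition _ (R : realType) (k : scalar_kind) :=
  GRing.isMonoidMorphism.Build R (Defs.scalar R k) (@of_real R k)
    (@of_real_is_monoid_morphism R k).
HB.instance Definition _ (R : realType) (k : scalar_kind) :=
  GRing.isZmodMorphism.Build (Defs.scalar R k) (Defs.scalar R k) (@scalar_conj R k)
    (@scalar_conj_is_zmod_morphism R k).
HB.instance Definition _ (R : realType) (k : scalar_kind) :=
  GRing.isMonoidMorphism.Build (Defs.scalar R k) (Defs.scalar R k) (@scalar_conj R k)
    (@scalar_conj_is_monoid_morphism R k).

Section Scalars.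
Variables (R : realType) (k : scalar_kind).
Local Notation F := (Defs.scalar R k).
Local Notation "t %:Sc" := (of_real k t) (at level 1, format "t %:Sc").

Lemma ler_of_real (s t : R) : (s%:Sc <= t%:Sc) = (s <= t).
Proof. by case: k => //; rewrite /of_real /= lecR. Qed.

Lemma ltr_of_real (s t : R) : (s%:Sc < t%:Sc) = (s < t).
Proof. by case: k => //; rewrite /of_real /= ltcR. Qed.

Lemma of_real_inj : injective (@of_real R k).
Proof. exact: fmorph_inj. Qed.

Lemma real_partK (z : F) : 0 <= z -> (real_part z)%:Sc = z.
Proof.
rewrite /real_part /of_real; case: k z => // -[a b].
by rewrite lecE /= => /andP[/eqP -> _].
Qed.

Lemma conj_of_real (t : R) : scalar_conj t%:Sc = t%:Sc.
Proof. by case: k => //; rewrite /scalar_conj /of_real /= conj_Creal// complex_real. Qed.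

Lemma mul_conj (z : F) : z * scalar_conj z = `|z| ^+ 2.
Proof.
case: k z => /= z; last by rewrite normCK.
by rewrite -expr2 real_normK// num_real.
Qed.

(** The norm of the scalar field takes its values in that field; square sums
    of coefficients are compared in [R], where monotone sequences converge. *)
Definition modulus (z : F) : R := real_part `|z|.

Lemma modulusE (z : F) : (modulus z)%:Sc = `|z|.
Proof. exact: real_partK. Qed.

Lemma modulus_ge0 (z : F) : 0 <= modulus z.
Proof. by rewrite -ler_of_real modulusE rmorph0. Qed.

Lemma norm_of_real (t : R) : `|t%:Sc| = `|t|%:Sc.
Proof.
have [t0|t0] := leP 0 t; first by rewrite !ger0_norm// -(rmorph0 (of_real k)) ler_of_real.
by rewrite !ltr0_norm ?rmorphN// -(rmorph0 (of_real k)) ltr_of_real.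
Qed.

Lemma modulusM (t : R) (z : F) : modulus (t%:Sc * z) = `|t| * modulus z.
Proof. by apply: of_real_inj; rewrite rmorphM /= !modulusE normrM norm_of_real. Qed.

End Scalars.

(** * Orthonormal series in a Hilbert space *)

Section Hilbert.
Variables (R : realType) (k : scalar_kind) (X : hilbert R k).
Local Notation F := (Defs.scalar R k).
Local Notation "t %:Sc" := (of_real k t) (at level 1, format "t %:Sc").
Implicit Types x y : X.

Lemma hnormE x : (hnorm x)%:Sc = `|x|.
Proof. exact: real_partK. Qed.

Lemma hnorm0 : hnorm (0 : X) = 0.
Proof. by rewrite /hnorm normr0 /real_part; case: (k). Qed.

Lemma hnorm_ge0 x : 0 <= hnorm x.
Proof. by rewrite -(ler_of_real k) hnormE rmorph0. Qed.

Lemma ler_hnormD x y : hnorm (x + y) <= hnorm x + hnorm y.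
Proof. by rewrite -(ler_of_real k) rmorphD /= !hnormE ler_normD. Qed.

Lemma sqr_hnorm x : (hnorm x ^+ 2)%:Sc = ip x x.
Proof. by rewrite rmorphXn /= hnormE inner_norm. Qed.

Lemma ipC x y : ip x y = scalar_conj (ip y x).
Proof. by rewrite /ip hermC expr0 mul1r. Qed.

Lemma ip_suml (I : Type) (r : seq I) (P : pred I) (f : I -> X) y :
  ip (\sum_(i <- r | P i) f i) y = \sum_(i <- r | P i) ip (f i) y.
Proof. by rewrite /ip linear_sumlz. Qed.

Lemma ipZl (a : F) x y : ip (a *: x) y = a * ip x y.
Proof. by rewrite /ip linearZl_LR. Qed.

Lemma ipBl x y z : ip (x - y) z = ip x z - ip y z.
Proof. by rewrite /ip linearBl. Qed.

Lemma ipDl x y z : ip (x + y) z = ip x z + ip y z.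
Proof. by rewrite /ip linearDl. Qed.

Lemma ipDr x y z : ip x (y + z) = ip x y + ip x z.
Proof. by rewrite /ip linearDr. Qed.

Lemma ipZr (a : F) x y : ip x (a *: y) = scalar_conj a * ip x y.
Proof. by rewrite ipC ipZl rmorphM /= -ipC. Qed.

Lemma hnorm_pythagoras x y : ip x y = 0 ->
  hnorm (x + y) ^+ 2 = hnorm x ^+ 2 + hnorm y ^+ 2.
Proof.
move=> xy0; apply: (@of_real_inj _ k); rewrite rmorphD /= !sqr_hnorm.
by rewrite ipDl !ipDr xy0 (ipC y x) xy0 rmorph0 addr0 add0r.
Qed.

Lemma cvg_hnormP (f : nat -> X) x :
  f @ \oo --> x <->
  forall e : R, 0 < e -> \forall N \near \oo, hnorm (x - f N) <= e.
Proof.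
split=> [/cvgrPdist_le fx e e0|fx].
  have := fx e%:Sc; rewrite -(rmorph0 (of_real k)) ltr_of_real => /(_ e0).
  by apply: filterS => N; rewrite -hnormE ler_of_real.
apply/cvgrPdist_le => e e0.
have := fx (real_part e); rewrite -(ltr_of_real k) real_partK ?ltW// rmorph0.
move=> /(_ e0); apply: filterS => N.
by rewrite -(ler_of_real k) hnormE real_partK// ltW.
Qed.

Section Orthonormal.
Variables (I : pred nat) (e : nat -> X).
Hypothesis oe : orthonormal_on I e.
Implicit Types a b : nat -> F.

Definition psum a N : X := \sum_(0 <= m < N | I m) a m *: e m.

Lemma eq_psum a b : (forall m, I m -> a m = b m) -> psum a = psum b.
Proof. by move=> ab; apply/funext => N; apply: eq_bigr => m /ab ->. Qed.

Lemma psum_lin a b (c : F) x y : psum a @ \oo --> x -> psum b @ \oo --> y ->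
  psum (fun m => a m + c * b m) @ \oo --> x + c *: y.
Proof.
move=> ax bxy; have -> : psum (fun m => a m + c * b m) = psum a + c \*: psum b.
  apply/funext => N; rewrite /psum /GRing.add /= scaler_sumr -big_split.
  by apply: eq_bigr => m _; rewrite scalerDl scalerA.
by apply: cvgD => //; exact: cvgZl_tmp.
Qed.

Lemma ip_psum a N m : I m -> ip (psum a N) (e m) = (if (m < N)%N then a m else 0).
Proof.
move=> Im; rewrite ip_suml; elim: N => [|N IH]; first by rewrite big_geq.
rewrite big_mkcond big_nat_recr //= -big_mkcond IH {IH}.
have [IN|IN] := boolP (I N); last first.
  rewrite addr0 ltnS (leq_eqVlt m N); case: eqP => [mN|//]; by move: IN; rewrite -mN Im.
rewrite ipZl oe// ltnS (leq_eqVlt m N) (eq_sym N m).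
by have [->|mN] /= := eqVneq m N; rewrite ?ltnn ?mulr1 ?add0r ?mulr0 ?addr0.
Qed.

(** The lower bound of the range is arbitrary so that the identity applies to
    the blocks in the Cauchy criterion as well as to initial sums. *)
Lemma hnorm_sum_sqr a p N :
  hnorm (\sum_(p <= m < N | I m) a m *: e m) ^+ 2
  = \sum_(p <= m < N | I m) modulus (a m) ^+ 2.
Proof.
have [Np|pN] := leqP N p; first by rewrite !big_geq// hnorm0 expr0n.
elim: N pN => // N IH; rewrite ltnS => pN.
rewrite !(big_mkcond I) !big_nat_recr//= -!(big_mkcond I)/=.
set s := \sum_(_ <= _ < _ | _) _ *: _.
have {}IH : hnorm s ^+ 2 = \sum_(p <= m < N | I m) modulus (a m) ^+ 2.
  move: pN; rewrite leq_eqVlt => /predU1P[pN|/IH//].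
  by rewrite /s pN !big_geq// hnorm0 expr0n.
case: ifPn => IN; last by rewrite !addr0.
rewrite hnorm_pythagoras ?IH.
  congr (_ + _); apply: (@of_real_inj _ k).
  rewrite sqr_hnorm ipZl ipZr oe// eqxx mulr1 mul_conj -modulusE -rmorphXn//.
rewrite /s ip_suml big_nat_cond big1// => m /andP[/andP[_ mN] Im].
by rewrite ipZr ipZl oe// (ltn_eqF mN) !mulr0.
Qed.

(** The residual of the orthogonal projection is orthogonal to it. *)
Lemma bessel x N : \sum_(0 <= m < N | I m) modulus (ip x (e m)) ^+ 2 <= hnorm x ^+ 2.
Proof.
rewrite -hnorm_sum_sqr -/(psum (fun m => ip x (e m)) N); set s := psum _ N.
rewrite -[x in leRHS](subrK s) addrC hnorm_pythagoras ?lerDl ?sqr_ge0//.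
rewrite ip_suml big_nat_cond big1// => m /andP[/andP[_ mN] Im].
by rewrite ipZl (ipC (e m)) ipBl ip_psum// mN subrr rmorph0 mulr0.
Qed.

(** By Pythagoras the blocks of the series have the same size as the blocks of
    the series of squared moduli, which is monotone and bounded; so the partial
    sums are Cauchy. *)
Lemma riesz_fischer a (M : R) :
  (forall N, \sum_(0 <= m < N | I m) modulus (a m) ^+ 2 <= M) ->
  cvgn (psum a).
Proof.
move=> aM; pose c m := if I m then modulus (a m) ^+ 2 else 0.
have cE p N : \sum_(p <= m < N | I m) modulus (a m) ^+ 2 = \sum_(p <= m < N) c m.
  by rewrite big_mkcond.
have c_cvg : cvgn (series c).
  apply: nondecreasing_is_cvgn.
    apply: nondecreasing_series => m _ _; rewrite /c; case: ifP => // _.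
    exact: sqr_ge0.
  by exists M => _ [N _ <-]; rewrite /series /= -cE.
pose w m := if I m then a m *: e m else 0.
rewrite (_ : psum a = series w); last first.
  by apply/funext => N; rewrite /psum big_mkcond.
apply/cauchy_cvgP/cauchy_seriesP => eps eps0.
have e0 : 0 < real_part eps.
  by rewrite -(ltr_of_real k) real_partK ?rmorph0// ltW.
have /cauchy_cvgP/cauchy_seriesP/(_ (real_part eps ^+ 2)) := c_cvg.
rewrite exprn_gt0// => /(_ isT); apply: filterS => -[p N] /=.
rewrite -cE -hnorm_sum_sqr ger0_norm ?sqr_ge0// ltr_pXn2r ?nnegrE ?hnorm_ge0 ?ltW//.
by rewrite -(ltr_of_real k) hnormE real_partK 1?ltW// big_mkcond.
Qed.

(** Bessel's inequality for the difference [x - psum a N], whose [m]-th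
    coefficient no longer depends on [N] once [m < N]. *)
Lemma coef_lim a x m : psum a @ \oo --> x -> I m -> ip x (e m) = a m.
Proof.
move=> /cvg_hnormP ax Im; apply/eqP; rewrite -subr_eq0 -normr_eq0 -modulusE.
rewrite fmorph_eq0 eq_le modulus_ge0 andbT; apply/ler_addgt0Pl => eps eps0.
rewrite addr0.
have [N _ hN] := ax _ eps0.
apply: le_trans (hN (maxn N m.+1) (leq_maxl _ _)).
have mN : (m < maxn N m.+1)%N := leq_maxr _ _.
have -> : ip x (e m) - a m = ip (x - psum a (maxn N m.+1)) (e m).
  by rewrite ipBl ip_psum// mN.
rewrite -(@ler_pXn2r _ 2)// ?nnegrE ?hnorm_ge0 ?modulus_ge0//.
apply: le_trans (bessel _ m.+1).
rewrite big_mkcond big_nat_recr//= Im lerDr sumr_ge0// => p _.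
by case: ifP => // _; rewrite sqr_ge0.
Qed.

Lemma hnorm_lim_le a x (M : R) : 0 <= M -> psum a @ \oo --> x ->
  (forall N, \sum_(0 <= m < N | I m) modulus (a m) ^+ 2 <= M ^+ 2) ->
  hnorm x <= M.
Proof.
move=> M0 /cvg_hnormP ax aM; apply/ler_addgt0Pl => eps eps0.
have [N _ hN] := ax _ eps0.
rewrite -[x](subrK (psum a N)); apply: le_trans (ler_hnormD _ _) _.
apply: lerD; first exact: hN N (leqnn N).
rewrite -(@ler_pXn2r _ 2)// ?nnegrE ?hnorm_ge0//.
by rewrite /psum hnorm_sum_sqr aM.
Qed.

End Orthonormal.
End Hilbert.

(** * Estimates on the filter function *)

Section FilterEstimates.
Variables (R : realType) (r : R) (n : nat).
Hypothesis r0 : 0 < r.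
Implicit Types a t : R.

(** The factor by which one iteration reduces the component of the error that
    belongs to the singular value [t]. *)
Definition residual a t : R := a / (t `^ (r + 1) + a).

Lemma residual_itv a t : 0 < a -> 0 < residual a t <= 1.
Proof.
move=> a0; have b0 := powR_ge0 t (r + 1).
have ba : 0 < t `^ (r + 1) + a by rewrite ltr_wpDl.
by rewrite /residual divr_gt0//= ler_pdivrMr// mul1r lerDr.
Qed.

Lemma siwt_filterE a t : 0 < a -> siwt_filter r n a t = 1 - residual a t ^+ n.
Proof.
move=> a0; have ba : t `^ (r + 1) + a != 0 by rewrite gt_eqF// ltr_wpDl// powR_ge0.
by rewrite /siwt_filter /residual mulrBl expr_div_n divff// expf_neq0.
Qed.

Lemma siwt_filter_itv a t : 0 < a -> 0 <= siwt_filter r n a t <= 1.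
Proof.
move=> a0; rewrite siwt_filterE//; have /andP[q0 q1] := residual_itv t a0.
by rewrite subr_ge0 exprn_ile1 ?(ltW q0)//= gerBl exprn_ge0// ltW.
Qed.

Lemma bernoulli_le (q : R) : 0 <= q <= 1 -> 1 - q ^+ n <= n%:R * (1 - q).
Proof.
move=> /andP[q0 q1]; elim: n => [|m IH]; first by rewrite expr0 subrr mul0r.
have qm : q ^+ m <= 1 by rewrite exprn_ile1.
rewrite exprS -natr1.
have : q * (1 - q ^+ m) <= 1 - q ^+ m by rewrite ler_piMl// subr_ge0.
by move: IH; set z := q ^+ m; set w := m%:R; nra.
Qed.

(** The hypothesis [nu <= n (r + 1)] is the saturation of the method: it allows
    the exponent [n] to be lowered to [nu / (r + 1)], after which
    [residual a t * t^(r+1) <= a] is raised to that power. *)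
Lemma residual_rate (nu a t : R) : 0 < nu -> nu <= n%:R * (r + 1) -> 0 < a -> 0 < t ->
  residual a t ^+ n * t `^ nu <= a `^ (nu / (r + 1)).
Proof.
move=> nu0 nun a0 t0; have r10 : 0 < r + 1 by rewrite addr_gt0.
have /andP[q0 q1] := residual_itv t a0.
have b0 : 0 < t `^ (r + 1) by rewrite powR_gt0.
have -> : t `^ nu = (t `^ (r + 1)) `^ (nu / (r + 1)).
  by rewrite -powRrM mulrC divfK// gt_eqF.
apply: (@le_trans _ _
  (residual a t `^ (nu / (r + 1)) * (t `^ (r + 1)) `^ (nu / (r + 1)))).
  rewrite ler_wpM2r ?powR_ge0// -powR_mulrn ?(ltW q0)// ger_powR ?q0//.
  by rewrite ler_pdivrMr.
rewrite -powRM ?(ltW q0) ?(ltW b0)//.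
apply: ge0_ler_powR; last first.
- by rewrite /residual mulrAC ler_pdivrMr ?addr_gt0// ler_pM2l// lerDl ltW.
- by rewrite nnegrE ltW.
- by rewrite nnegrE mulr_ge0// ltW.
- by rewrite divr_ge0// ltW.
Qed.

(** After Bernoulli's inequality, [1 - q] lies in ]0, 1], so that raising it to
    the power [1 / (r + 1) <= 1] increases it; this trades the factor
    [t^(r+1) / a] for [t / a^(1/(r+1))], which cancels the division by [t]. *)
Lemma siwt_filter_div_le a t : 0 < a -> 0 < t ->
  siwt_filter r n a t / t <= n%:R * a `^ (- (r + 1)^-1).
Proof.
move=> a0 t0; have r10 : 0 < r + 1 by rewrite addr_gt0.
have /andP[q0 q1] := residual_itv t a0.
have b0 : 0 < t `^ (r + 1) by rewrite powR_gt0.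
rewrite siwt_filterE// ler_pdivrMr//.
apply: (@le_trans _ _ (n%:R * (1 - residual a t))); first by rewrite bernoulli_le// (ltW q0).
rewrite -mulrA ler_wpM2l ?ler0n//.
have qE : 1 - residual a t = t `^ (r + 1) / (t `^ (r + 1) + a).
  by rewrite /residual; field; rewrite gt_eqF// addr_gt0.
have p0 : 0 < 1 - residual a t by rewrite qE divr_gt0// addr_gt0.
apply: (@le_trans _ _ ((1 - residual a t) `^ (r + 1)^-1)).
  apply: ger1_powR; first by rewrite p0 gerBl ltW.
  by rewrite invf_le1// lerDr ltW.
apply: (@le_trans _ _ ((t `^ (r + 1) / a) `^ (r + 1)^-1)).
  apply: ge0_ler_powR; last by rewrite qE ler_pM2l// lef_pV2 ?posrE ?addr_gt0// lerDr ltW.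
  - by rewrite invr_ge0 ltW.
  - by rewrite nnegrE ltW.
  - by rewrite nnegrE divr_ge0// ltW.
rewrite powRM ?invr_ge0 ?(ltW b0) ?(ltW a0)// -powRrM divff ?gt_eqF// powRr1 ?(ltW t0)//.
by rewrite mulrC -powR_inv1 ?(ltW a0)// -powRrM mulN1r.
Qed.

Lemma siwt_filter_cvg t : (0 < n)%N -> 0 < t ->
  siwt_filter r n a t @[a --> 0^'+] --> (1 : R).
Proof.
move=> n0 t0; have b0 : 0 < t `^ (r + 1) by rewrite powR_gt0.
apply/cvgrPdist_le => e e0; near=> a.
have a0 : 0 < a by near: a; exact: nbhs_right_gt.
have /andP[q0 q1] := residual_itv t a0.
rewrite siwt_filterE// opprB addrC subrK ger0_norm ?exprn_ge0 ?(ltW q0)//.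
apply: (@le_trans _ _ (residual a t)).
  by rewrite -[leRHS]expr1 ler_wiXn2l ?(ltW q0).
rewrite /residual ler_pdivrMr ?addr_gt0//.
apply: (@le_trans _ _ (e * t `^ (r + 1))).
  by near: a; apply: nbhs_right_le; rewrite mulr_gt0.
by rewrite ler_pM2l// lerDl ltW.
Unshelve. all: by end_near. Qed.

Lemma measurable_siwt_filter a : 0 < a ->
  measurable_fun (`[0, +oo[ : set R) (siwt_filter r n a).
Proof.
move=> a0; apply: measurable_funTS.
(* The inverse is written as the power -1, which is measurable everywhere. *)
rewrite (_ : siwt_filter r n a = fun t => 1 - (a * (t `^ (r + 1) + a) `^ (-1)) ^+ n).
  apply: measurable_funB => //; apply: measurable_funX; apply: measurable_funM => //.
  apply: (measurableT_comp (measurable_powR _)).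
  by apply: measurable_funD.
apply/funext => t; rewrite siwt_filterE// /residual powR_inv1//.
by rewrite addr_ge0 ?powR_ge0// ltW.
Qed.

(** The parameter for which the bounds on the approximation error and on the
    propagated noise have the same order. *)
Lemma balanced_rate (nu delta rho : R) : 0 < nu -> 0 < delta -> 0 < rho ->
  let a := (delta / rho) `^ ((r + 1) / (nu + 1)) in
  a `^ (nu / (r + 1)) * rho + n%:R * a `^ (- (r + 1)^-1) * delta
  = (n%:R + 1) * delta `^ (nu / (nu + 1)) * rho `^ (nu + 1)^-1.
Proof.
move=> nu0 d0 h0 a; have r10 : 0 < r + 1 by rewrite addr_gt0.
have nu1 : nu + 1 != 0 by rewrite gt_eqF// addr_gt0.
have r1 : r + 1 != 0 by rewrite gt_eqF.
have powRV (x y : R) : 0 < x -> x^-1 `^ y = x `^ (- y).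
  by move=> x0; rewrite -powR_inv1 ?(ltW x0)// -powRrM mulN1r.
have aE s : a `^ s = delta `^ ((r + 1) / (nu + 1) * s)
    * rho `^ (- ((r + 1) / (nu + 1) * s)).
  by rewrite /a -powRrM powRM ?invr_ge0 ?(ltW d0) ?(ltW h0)// powRV.
rewrite !aE.
have -> : (r + 1) / (nu + 1) * (nu / (r + 1)) = nu / (nu + 1) by field; apply/andP.
have -> : (r + 1) / (nu + 1) * - (r + 1)^-1 = - (nu + 1)^-1 by field; apply/andP.
have hE : rho `^ (- (nu / (nu + 1))) * rho = rho `^ (nu + 1)^-1.
  rewrite -{2}[rho]powRr1 ?(ltW h0)// -powRD ?(gt_eqF h0) ?implybT//.
  by congr (_ `^ _); field.
have dE : delta `^ (- (nu + 1)^-1) * delta = delta `^ (nu / (nu + 1)).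
  rewrite -{2}[delta]powRr1 ?(ltW d0)// -powRD ?(gt_eqF d0) ?implybT//.
  by congr (_ `^ _); field.
by rewrite -mulrA hE opprK -dE; ring.
Qed.

End FilterEstimates.

(** * Diagonal operators of the singular system *)

Section Diagonal.
Variables (R : realType) (k : scalar_kind).
Local Notation F := (Defs.scalar R k).
Local Notation "t %:Sc" := (of_real k t) (at level 1, format "t %:Sc").

(** A bounded multiplier keeps square sums bounded, by Bessel's inequality; this
    gives both the convergence and the norm bound of every diagonal series. *)
Lemma sum_diag_le (Z : hilbert R k) (I : pred nat) (f : nat -> Z) (c : nat -> R)
    (C : R) (z : Z) (N : nat) : orthonormal_on I f ->
  (forall m, I m -> `|c m| <= C) -> 0 <= C ->
  \sum_(0 <= m < N | I m) modulus ((c m)%:Sc * ip z (f m)) ^+ 2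
  <= (C * hnorm z) ^+ 2.
Proof.
move=> of_ cC C0; rewrite exprMn.
apply: le_trans (ler_wpM2l (exprn_ge0 2 C0) (bessel of_ z N)).
rewrite mulr_sumr; apply: ler_sum => m Im.
by rewrite modulusM exprMn ler_wpM2r ?sqr_ge0// lerXn2r ?nnegrE ?cC.
Qed.

Variables (X Y : hilbert R k) (K : {linear X -> Y}) (Ks : Y -> X) (S : sve K Ks).
Local Notation s := (sv S).
Local Notation v := (rvec S).
Local Notation u := (lvec S).
Local Notation ov := (@rvec_orthonormal _ _ _ _ _ _ S).
Local Notation ou := (@lvec_orthonormal _ _ _ _ _ _ S).

Lemma hilbert_lim (f : nat -> X) (x : X) : f @ \oo --> x -> limn f = x.
Proof. exact: (cvg_lim (@norm_hausdorff _ X)). Qed.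

Lemma hilbert_cvg_unique (f : nat -> X) (x x' : X) :
  f @ \oo --> x -> f @ \oo --> x' -> x = x'.
Proof. by move=> /hilbert_lim <- /hilbert_lim. Qed.

Lemma uv_sum_cvg c (C : R) y : (forall m, idx S m -> `|c m| <= C) -> 0 <= C ->
  uv_sum S c y @ \oo --> limn (uv_sum S c y).
Proof.
move=> cC C0; apply: (riesz_fischer ov (M := (C * hnorm y) ^+ 2)) => N.
exact: (sum_diag_le _ _ ou).
Qed.

Lemma vv_sum_cvg c (C : R) x : (forall m, idx S m -> `|c m| <= C) -> 0 <= C ->
  vv_sum S c x @ \oo --> limn (vv_sum S c x).
Proof.
move=> cC C0; apply: (riesz_fischer ov (M := (C * hnorm x) ^+ 2)) => N.
exact: (sum_diag_le _ _ ov).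
Qed.

Lemma uv_lim_le c (C : R) y x : (forall m, idx S m -> `|c m| <= C) -> 0 <= C ->
  uv_sum S c y @ \oo --> x -> hnorm x <= C * hnorm y.
Proof.
move=> cC C0 yx; apply: (hnorm_lim_le ov _ yx).
  by rewrite mulr_ge0 ?hnorm_ge0.
by move=> N; exact: (sum_diag_le _ _ ou).
Qed.

Lemma vv_lim_le c (C : R) w x : (forall m, idx S m -> `|c m| <= C) -> 0 <= C ->
  vv_sum S c w @ \oo --> x -> hnorm x <= C * hnorm w.
Proof.
move=> cC C0 wx; apply: (hnorm_lim_le ov _ wx).
  by rewrite mulr_ge0 ?hnorm_ge0.
by move=> N; exact: (sum_diag_le _ _ ov).
Qed.

Lemma uv_lim_coef c y x m : uv_sum S c y @ \oo --> x -> idx S m ->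
  ip x (v m) = (c m)%:Sc * ip y (u m).
Proof. exact: (coef_lim (a := fun m => (c m)%:Sc * ip y (u m)) ov). Qed.

Lemma vv_lim_coef c w x m : vv_sum S c w @ \oo --> x -> idx S m ->
  ip x (v m) = (c m)%:Sc * ip w (v m).
Proof. exact: (coef_lim (a := fun m => (c m)%:Sc * ip w (v m)) ov). Qed.

Lemma sv_powR_le (p : R) m : 0 <= p -> idx S m -> `|s m `^ p| <= s 0%N `^ p.
Proof.
move=> p0 Im; have I0 := idx_down (leq0n m) Im.
rewrite ger0_norm ?powR_ge0//; apply: ge0_ler_powR => //.
- by rewrite nnegrE ltW// sv_gt0.
- by rewrite nnegrE ltW// sv_gt0.
- exact: sv_noninc.
Qed.

Lemma normal_pow_cvg (p : R) (x : X) : 0 <= p ->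
  vv_sum S (fun m => s m `^ (2 * p)) x @ \oo --> normal_pow S p x.
Proof.
move=> p0; apply: (vv_sum_cvg (C := s 0%N `^ (2 * p))); rewrite ?powR_ge0// => m.
by apply: sv_powR_le; rewrite mulr_ge0.
Qed.

Lemma weighted_adjoint_cvg (r : R) (y : Y) : 0 <= r ->
  uv_sum S (fun m => s m `^ r) y @ \oo --> weighted_adjoint S r y.
Proof.
move=> r0; apply: (uv_sum_cvg (C := s 0%N `^ r)); rewrite ?powR_ge0// => m.
exact: sv_powR_le.
Qed.

Lemma normal_pow_coef (p : R) (x : X) m : 0 <= p -> idx S m ->
  ip (normal_pow S p x) (v m) = (s m `^ (2 * p))%:Sc * ip x (v m).
Proof. move=> p0; exact: (vv_lim_coef (@normal_pow_cvg _ x p0)). Qed.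

(** * The iterates as filtered series *)

Section Iterates.
Variables (r a : R).
Hypotheses (r0 : 0 < r) (a0 : 0 < a).

Definition filtered n y : X :=
  limn (uv_sum S (fun m => siwt_filter r n a (s m) / s m) y).

Lemma siwt_filter_div_bound n m : idx S m ->
  `|siwt_filter r n a (s m) / s m| <= n%:R * a `^ (- (r + 1)^-1).
Proof.
move=> Im; have s0 := sv_gt0 Im.
have /andP[F0 _] := siwt_filter_itv r n (s m) a0.
have h0 : 0 <= siwt_filter r n a (s m) / s m by rewrite divr_ge0// ltW.
by rewrite (ger0_norm h0); exact: siwt_filter_div_le.
Qed.

Lemma filtered_cvg n y :
  uv_sum S (fun m => siwt_filter r n a (s m) / s m) y @ \oo --> filtered n y.
Proof.
apply: (uv_sum_cvg (C := n%:R * a `^ (- (r + 1)^-1))).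
  exact: siwt_filter_div_bound.
by rewrite mulr_ge0 ?powR_ge0.
Qed.

Lemma filtered_coef n y m : idx S m ->
  ip (filtered n y) (v m) = (siwt_filter r n a (s m) / s m)%:Sc * ip y (u m).
Proof. exact: (uv_lim_coef (@filtered_cvg n y)). Qed.

Lemma filtered_sub n y y' : filtered n y - filtered n y' = filtered n (y - y').
Proof.
apply/esym/hilbert_lim.
rewrite (_ : uv_sum _ _ _ = fun N =>
  uv_sum S (fun m => siwt_filter r n a (s m) / s m) y N -
  uv_sum S (fun m => siwt_filter r n a (s m) / s m) y' N); last first.
  apply/funext => N; rewrite /uv_sum -sumrB; apply: eq_bigr => m _.
  by rewrite -scalerBl -mulrBr ipBl.
by apply: cvgB; exact: filtered_cvg.
Qed.

(** The iteration read in the direction of one singular value [t], for a datum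
    with coefficient 1: [(t^(r+1) + a) (1 - q^(n+1)) = t^(r+1) + a (1 - q^n)],
    because [(t^(r+1) + a) q = a]. *)
Lemma filter_recursion n t : 0 < t ->
  t `^ (r + 1) * (siwt_filter r n.+1 a t / t) + a * (siwt_filter r n.+1 a t / t)
  = t `^ r + a * (siwt_filter r n a t / t).
Proof.
move=> t0; have b0 : 0 < t `^ (r + 1) by rewrite powR_gt0.
have ba : t `^ (r + 1) + a != 0 by rewrite gt_eqF// addr_gt0.
have tr : t `^ (r + 1) = t `^ r * t.
  by rewrite powRD ?(gt_eqF t0) ?implybT// powRr1// ltW.
have -> : t `^ r = t `^ (r + 1) / t by rewrite tr mulfK// gt_eqF.
rewrite !siwt_filterE// -mulrDl exprS /residual; set q := (_ / _) ^+ n.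
by field; rewrite gt_eqF.
Qed.

Lemma filtered_step n y :
  normal_pow S ((r + 1) / 2) (filtered n.+1 y) + a%:Sc *: filtered n.+1 y
  = weighted_adjoint S r y + a%:Sc *: filtered n y.
Proof.
have p0 : 0 <= (r + 1) / 2 by rewrite divr_ge0 ?addr_ge0 ?(ltW r0).
pose g l m := (siwt_filter r l a (s m) / s m)%:Sc * ip y (u m).
pose fl m := (s m `^ (2 * ((r + 1) / 2)))%:Sc * ip (filtered n.+1 y) (v m)
  + a%:Sc * g n.+1 m.
pose fr m := (s m `^ r)%:Sc * ip y (u m) + a%:Sc * g n m.
have cl : psum (idx S) v fl @ \oo -->
    normal_pow S ((r + 1) / 2) (filtered n.+1 y) + a%:Sc *: filtered n.+1 y.
  by apply: psum_lin; [exact: normal_pow_cvg | exact: filtered_cvg].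
have cr : psum (idx S) v fr @ \oo -->
    weighted_adjoint S r y + a%:Sc *: filtered n y.
  by apply: psum_lin; [apply: weighted_adjoint_cvg; exact: ltW | exact: filtered_cvg].
suff e : psum (idx S) v fl = psum (idx S) v fr.
  by apply: (hilbert_cvg_unique cl); rewrite e.
apply: eq_psum => m Im; rewrite /fl /fr.
have -> : 2 * ((r + 1) / 2) = r + 1 by field.
rewrite filtered_coef// /g !mulrA -!rmorphM -!mulrDl -!rmorphD /=.
by congr (of_real _ _ * _); rewrite filter_recursion// sv_gt0.
Qed.

Lemma siwt_sequence_filtered y :
  siwt_sequence S r a y (fun m => filtered m y).
Proof.
split=> [|m]; last exact: filtered_step.
rewrite /filtered -[RHS](hilbert_lim (cvg_cst 0)); congr (limn _).
apply/funext => N; rewrite /uv_sum big1// => m _.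
by rewrite /siwt_filter !expr0 subrr !mul0r rmorph0 mul0r scale0r.
Qed.

(** Two solutions of one step have the same coefficients, as
    [s_m^(r+1) + a > 0]; hence they have the same image under
    [(K^* K)^((r+1)/2)], and then [a] times them is the same. In this way
    components orthogonal to all [v_m] are covered too. *)
Lemma siwt_sequence_unique y x x' :
  siwt_sequence S r a y x -> siwt_sequence S r a y x' -> x = x'.
Proof.
move=> [x0 xS] [x'0 x'S]; apply/funext; elim=> [|n IH]; first by rewrite x0.
have p0 : 0 <= (r + 1) / 2 by rewrite divr_ge0 ?addr_ge0 ?(ltW r0).
have e := xS n; rewrite IH -x'S in e.
have ae : a%:Sc != 0 by rewrite fmorph_eq0 gt_eqF.
suff E : normal_pow S ((r + 1) / 2) (x n.+1) = normal_pow S ((r + 1) / 2) (x' n.+1).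
  by move: e; rewrite E => /addrI /(scalerI ae).
congr (limn _); apply: eq_psum => m Im; congr (_ * _).
have := congr1 (fun z => ip z (v m)) e.
rewrite !ipDl !ipZl !normal_pow_coef// -!mulrDl -rmorphD => /mulfI; apply.
by rewrite fmorph_eq0 gt_eqF// ltr_wpDl// powR_ge0.
Qed.

Lemma siwtE n y : siwt S r n a y = filtered n y.
Proof.
have h := siwt_sequence_filtered y.
rewrite /siwt (siwt_sequence_unique (xgetPex (fun=> 0) (ex_intro _ _ h)) h)//.
Qed.

End Iterates.

(** * Error estimates *)

Section Error.
Variables (r : R) (n : nat).
Hypotheses (r0 : 0 < r) (KKs : adjoint K Ks).

Lemma ip_range x m : idx S m -> ip (K x) (u m) = (s m)%:Sc * ip x (v m).
Proof. by move=> Im; rewrite KKs sv_lvec// ipZr conj_of_real. Qed.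

Variables (y : Y).
Hypothesis Ky : range K y.
Local Notation xd := (mp_inverse S y).

(** If [y = K x] then [<y, u_m> = s_m <x, v_m>], so the series of the
    Moore-Penrose inverse is the orthogonal expansion of [x]; it converges, and
    its sum has the same coefficients as [x]. *)
Lemma mp_inverse_spec :
  psum (idx S) v (fun m => ip xd (v m)) @ \oo --> xd /\
  forall m, idx S m -> ip y (u m) = (s m)%:Sc * ip xd (v m).
Proof.
have [x _ yx] := Ky.
have mpE : uv_sum S (fun m => (s m)^-1) y = psum (idx S) v (fun m => ip x (v m)).
  apply: eq_psum => m Im; rewrite -yx ip_range// mulrA -rmorphM mulVf ?rmorph1 ?mul1r//.
  by rewrite gt_eqF// sv_gt0.
have cx : psum (idx S) v (fun m => ip x (v m)) @ \oo --> xd.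
  rewrite /mp_inverse mpE; apply: (riesz_fischer ov (M := hnorm x ^+ 2)) => N.
  exact: (bessel ov).
have xm m : idx S m -> ip xd (v m) = ip x (v m) by exact: (coef_lim ov cx).
split=> [|m Im]; last by rewrite xm// -yx ip_range.
suff -> : psum (idx S) v (fun m => ip xd (v m)) = psum (idx S) v (fun m => ip x (v m)) by [].
exact: eq_psum.
Qed.

Lemma approx_error_cvg a : 0 < a ->
  vv_sum S (fun m => residual r a (s m) ^+ n) xd @ \oo --> xd - filtered r a n y.
Proof.
move=> a0; have [cx ym] := mp_inverse_spec.
pose f m := ip xd (v m) +
  (-1) * ((siwt_filter r n a (s m) / s m)%:Sc * ip y (u m)).
have cf : psum (idx S) v f @ \oo --> xd - filtered r a n y.
  by rewrite -scaleN1r; apply: psum_lin => //; exact: filtered_cvg.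
suff -> : vv_sum S (fun m => residual r a (s m) ^+ n) xd = psum (idx S) v f by [].
apply: eq_psum => m Im; have s0 : s m != 0 by rewrite gt_eqF// sv_gt0.
rewrite /f ym// mulrA -rmorphM divfK// siwt_filterE// rmorphB rmorph1.
by rewrite mulN1r mulrBl mul1r opprB addrC subrK.
Qed.

(** A source element [w] turns the approximation error into the diagonal
    series with multiplier [q^n s_m^nu] applied to [w]. *)
Lemma approx_error_le (nu rho a : R) : 0 < a -> 0 < nu -> nu <= n%:R * (r + 1) ->
  source_ball S nu rho xd ->
  hnorm (xd - filtered r a n y) <= a `^ (nu / (r + 1)) * rho.
Proof.
move=> a0 nu0 nun [w wrho xw].
have nu20 : 0 <= nu / 2 by rewrite divr_ge0// ltW.
apply: (@le_trans _ _ (a `^ (nu / (r + 1)) * hnorm w)); last first.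
  by rewrite ler_wpM2l ?powR_ge0.
have xm m : idx S m -> ip xd (v m) = (s m `^ nu)%:Sc * ip w (v m).
  by move=> Im; rewrite xw normal_pow_coef//; congr ((_ `^ _)%:Sc * _); field.
apply: (@vv_lim_le (fun m => residual r a (s m) ^+ n * s m `^ nu)).
- move=> m Im; have /andP[q0 _] := residual_itv r (s m) a0.
  rewrite ger0_norm ?mulr_ge0 ?exprn_ge0 ?powR_ge0 ?(ltW q0)//.
  by rewrite residual_rate// sv_gt0.
- exact: powR_ge0.
suff -> : vv_sum S (fun m => residual r a (s m) ^+ n * s m `^ nu) w =
    vv_sum S (fun m => residual r a (s m) ^+ n) xd by exact: approx_error_cvg.
by apply: eq_psum => m Im; rewrite xm// mulrA -rmorphM.
Qed.

(** The noise enters linearly, through the filtered series of [y - yd]. *)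
Lemma error_le (nu delta rho : R) (yd : Y) : 0 < nu -> nu <= n%:R * (r + 1) ->
  0 < delta -> 0 < rho -> source_ball S nu rho xd -> hnorm (y - yd) <= delta ->
  hnorm (xd - filtered r ((delta / rho) `^ ((r + 1) / (nu + 1))) n yd)
  <= (n%:R + 1) * delta `^ (nu / (nu + 1)) * rho `^ (nu + 1)^-1.
Proof.
move=> nu0 nun d0 h0 xs yyd; rewrite -(balanced_rate n r0)//; set a := _ `^ ((r + 1) / _).
have a0 : 0 < a by rewrite powR_gt0// divr_gt0.
rewrite -[xd](subrK (filtered r a n y)) -addrA.
apply: le_trans (ler_hnormD _ _) _; apply: lerD; first exact: approx_error_le.
rewrite filtered_sub//.
have c0 : 0 <= n%:R * a `^ (- (r + 1)^-1) by rewrite mulr_ge0// powR_ge0.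
apply: (@le_trans _ _ (n%:R * a `^ (- (r + 1)^-1) * hnorm (y - yd))).
  apply: (@uv_lim_le (fun m => siwt_filter r n a (s m) / s m)) => //.
    by move=> m; exact: siwt_filter_div_bound.
  exact: filtered_cvg.
by rewrite ler_wpM2l.
Qed.

(** The square sums of the candidate source coefficients are bounded one [N] at
    a time, with a parameter [a] that depends on [N] while the bound does
    not. *)
Lemma source_of_rate (C : R) : 0 <= C ->
  (\forall a \near 0^'+, hnorm (xd - filtered r a n y) <= C * a ^+ n) ->
  source_set S (n%:R * (r + 1)) xd.
Proof.
move=> C0 aC; have [cx _] := mp_inverse_spec; set nr := n%:R * (r + 1).
have r10 : 0 < r + 1 by rewrite addr_gt0.
have nr0 : 0 <= nr by rewrite mulr_ge0// ltW.
pose b m := (s m `^ (- nr))%:Sc * ip xd (v m).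
have bM N : \sum_(0 <= m < N | idx S m) modulus (b m) ^+ 2 <= (2 ^+ n * C) ^+ 2.
  elim: N => [|N IH]; first by rewrite big_geq// sqr_ge0.
  have [IN|IN] := boolP (idx S N); last first.
    by rewrite big_mkcond big_nat_recr//= (negbTE IN) addr0 -big_mkcond.
  have sN := sv_gt0 IN.
  (* Singular values decrease, so [a <= s_N^(r+1)] implies [a <= s_m^(r+1)] for
     all [m <= N]; this is where the factor 2 comes from. *)
  have [a [a0 aN aCa]] : exists a, [/\ 0 < a, a <= s N `^ (r + 1)
      & hnorm (xd - filtered r a n y) <= C * a ^+ n].
    have : \forall a \near (0 : R)^'+, [/\ 0 < a, a <= s N `^ (r + 1)
      & hnorm (xd - filtered r a n y) <= C * a ^+ n].
      near=> a; split; last by near: a.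
        by near: a; exact: nbhs_right_gt.
      by near: a; apply: nbhs_right_le; rewrite powR_gt0.
    by move=> /filter_ex.
  have an0 : 0 < a ^+ n by rewrite exprn_gt0.
  have := le_trans (bessel ov (xd - filtered r a n y) N.+1) _.
  move=> /(_ ((C * a ^+ n) ^+ 2)).
  rewrite lerXn2r ?nnegrE ?hnorm_ge0 ?mulr_ge0 ?(ltW an0)//.
  move=> /(_ isT) hs.
  rewrite -(@ler_pM2r _ ((a ^+ n / 2 ^+ n) ^+ 2)) ?exprn_gt0 ?divr_gt0//.
  have -> : (2 ^+ n * C) ^+ 2 * (a ^+ n / 2 ^+ n) ^+ 2 = (C * a ^+ n) ^+ 2.
    by field; rewrite expf_neq0.
  apply: le_trans hs; rewrite mulr_suml big_nat_cond [leRHS]big_nat_cond.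
  apply: ler_sum => m /andP[/andP[_ mN] Im].
  rewrite (vv_lim_coef (approx_error_cvg a0) Im) /b !modulusM.
  have b0 : 0 < s m `^ (r + 1) by rewrite powR_gt0// sv_gt0.
  have ab : a <= s m `^ (r + 1).
    apply: le_trans aN _; apply: ge0_ler_powR; last exact: sv_noninc.
    - exact: ltW.
    - by rewrite nnegrE ltW.
    - by rewrite nnegrE ltW// sv_gt0.
  have -> : s m `^ (- nr) = (s m `^ (r + 1)) ^- n.
    by rewrite powRN /nr mulrC powRrM powR_mulrn ?powR_ge0.
  have /andP[q0 _] := residual_itv r (s m) a0.
  rewrite !ger0_norm ?invr_ge0 ?exprn_ge0 ?(ltW b0) ?(ltW q0)// -exprMn mulrAC.
  rewrite lerXn2r ?nnegrE ?mulr_ge0 ?invr_ge0 ?exprn_ge0 ?modulus_ge0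
    ?(ltW b0) ?(ltW a0) ?(ltW q0)//.
  rewrite ler_wpM2r ?modulus_ge0// -!exprVn -!exprMn.
  rewrite lerXn2r ?nnegrE ?(ltW q0)// ?mulr_ge0 ?invr_ge0 ?(ltW b0) ?(ltW a0)//.
  rewrite /residual mulrCA -invfM ler_pM2l// lef_pV2 ?posrE ?addr_gt0 ?mulr_gt0//.
  by rewrite mulrDr mulr1 lerD2l.
have cb := riesz_fischer ov bM.
(* The radius of a source set is positive, and the source element may be 0. *)
exists (hnorm (limn (psum (idx S) v b)) + 1).
  by rewrite /= ltr_wpDl ?hnorm_ge0.
exists (limn (psum (idx S) v b)); first by rewrite lerDl.
apply: (hilbert_cvg_unique cx).
suff -> : psum (idx S) v (fun m => ip xd (v m)) =
    vv_sum S (fun m => s m `^ (2 * (nr / 2))) (limn (psum (idx S) v b)).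
  by apply: normal_pow_cvg; rewrite divr_ge0.
apply: eq_psum => m Im; rewrite (coef_lim ov cb Im) /b mulrA -rmorphM.
have -> : 2 * (nr / 2) = nr by field.
by rewrite powRN mulfV ?rmorph1 ?mul1r// gt_eqF// powR_gt0// sv_gt0.
Unshelve. all: by end_near. Qed.

End Error.
End Diagonal.

(** * Order of convergence of the method *)

Theorem proposition16 (R : realType) (k : scalar_kind) (X Y : hilbert R k)
    (K : {linear X -> Y}) (Ks : Y -> X) (S : sve K Ks) (n : nat) (r : R) :
  compact_operator K -> adjoint K Ks -> (1 <= n)%N -> 0 < r ->
  let nr := n%:R * (r + 1) in
  let Rm := siwt S r n in
  let alpha := fun delta rho : R => (delta / rho) `^ ((r + 1) / (1 + nr)) in
  [/\ forall (a : R) (y : Y), 0 < a -> exists! x, siwt_sequence S r a y x,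
      filter_method S +oo%E Rm (siwt_filter r n),
      forall nu : R, 0 < nu -> nu <= nr -> optimal_order S +oo%E Rm nu,
      (let rates := [set nu / (nu + 1) | nu in
                       [set nu : R | [/\ 0 < nu, nu <= nr
                                       & optimal_order S +oo%E Rm nu]]] in
       rates (nr / (1 + nr)) /\ ubound rates (nr / (1 + nr))) /\
      (optimal_order_with S alpha +oo%E Rm nr /\
       forall (rho : R) (y : Y) (yd : R -> Y), 0 < rho ->
         range K y -> source_ball S nr rho (mp_inverse S y) ->
         (forall delta, 0 < delta -> hnorm (y - yd delta) <= delta) ->
         (fun delta => hnorm (mp_inverse S y - Rm (alpha delta rho) (yd delta)) : R^o)
           =O_ (0^'+) (fun delta => delta `^ (nr / (1 + nr)) : R^o))
    & forall y : Y, range K y ->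
        (fun a => hnorm (mp_inverse S y - Rm a y) : R^o)
          =O_ (0^'+) (fun a => a ^+ n : R^o) ->
        source_set S nr (mp_inverse S y)].
Proof.
move=> _ KKs n1 r0 nr Rm alpha.
have r10 : 0 < r + 1 by rewrite addr_gt0.
have n0 : 0 < n%:R :> R by rewrite ltr0n.
have nr0 : 0 < nr by rewrite mulr_gt0.
have RmE a y : 0 < a -> Rm a y = filtered S r a n y by move=> a0; exact: siwtE.
have rate nu : 0 < nu -> nu <= nr -> optimal_order_with S
    (fun delta rho => (delta / rho) `^ ((r + 1) / (nu + 1))) +oo%E Rm nu.
  move=> nu0 nun; exists (n%:R + 1) => delta rho d0 h0.
  have a0 : 0 < (delta / rho) `^ ((r + 1) / (nu + 1)).
    by rewrite powR_gt0// divr_gt0.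
  split=> //; first exact: ltry.
  apply: ge_ereal_sup => _ [y [yd [Ky xs yyd ->]]].
  by rewrite lee_fin RmE//; exact: error_le.
have optimal nu : 0 < nu -> nu <= nr -> optimal_order S +oo%E Rm nu.
  by move=> nu0 nun; eexists; exact: rate.
split=> //.
- move=> a y a0; exists (fun m => filtered S r a m y).
  split; first exact: siwt_sequence_filtered.
  by move=> x; apply: siwt_sequence_unique => //; exact: siwt_sequence_filtered.
- split.
  + by move=> a a0 _; exact: measurable_siwt_filter.
  + by move=> a y a0 _; rewrite RmE//; exact: filtered_cvg.
  + move=> a a0 _; exists (n%:R * a `^ (- (r + 1)^-1)) => m.
    exact: siwt_filter_div_bound.
  + exists 1 => a m a0 _ _; have /andP[F0 F1] := siwt_filter_itv r n (sv S m) a0.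
    by rewrite ger0_norm.
  + by move=> m Im; apply: siwt_filter_cvg => //; exact: sv_gt0 Im.
- split; first split.
  + by exists nr; [split=> //; exact: optimal | rewrite (addrC nr)].
  + move=> _ [nu [nu0 nun _] <-].
    rewrite ler_pdivrMr ?addr_gt0// mulrAC ler_pdivlMr ?addr_gt0//.
    by rewrite !mulrDr !mulr1 (mulrC nr nu) addrC lerD2l.
  have alphaE : alpha = fun delta rho => (delta / rho) `^ ((r + 1) / (nr + 1)).
    by rewrite /alpha (addrC 1 nr).
  split; first by rewrite alphaE; exact: rate.
  move=> rho y yd h0 Ky xs yyd; apply/eqO_exP.
  exists ((n%:R + 1) * rho `^ (nr + 1)^-1).
    by rewrite mulr_gt0 ?powR_gt0// addr_gt0.
  near=> delta; have d0 : 0 < delta by near: delta; exact: nbhs_right_gt.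
  rewrite !ger0_norm ?hnorm_ge0 ?powR_ge0// alphaE.
  rewrite RmE ?powR_gt0 ?divr_gt0// (addrC 1 nr) mulrAC.
  by apply: error_le => //; exact: yyd.
- move=> y Ky /eqO_exP[C C0 hC]; apply: (source_of_rate r0 KKs Ky (ltW C0)).
  near=> a; have a0 : 0 < a by near: a; exact: nbhs_right_gt.
  rewrite -RmE//; have : `|hnorm (mp_inverse S y - Rm a y) : R^o| <= C * `|a ^+ n : R^o|.
    by near: a.
  by rewrite !ger0_norm ?hnorm_ge0 ?exprn_ge0// ltW.
Unshelve. all: by end_near. Qed.
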